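(* Let $\varphi$ be a comparison function and let $\mathcal{F}=((X,d),(f_i)_{i\in I})$ be a generalized possibly infinite iterated function system of order $m\in\mathbb{N}^*$ such that all the functions $f_i$, $i\in I$, are $\varphi$-contractions. Then the operator $H_{\mathcal{F}}:\mathcal{C}^m\to\mathcal{C}$ is Meir-Keeler.
   Context: $\mathbb{N}^{*}=\{1,2,\dots\}$. The sets $X$ and $I$ are nonempty. For a metric space $(Y,\rho)$ and $m\in\mathbb{N}^*$, $Y^m$ carries the maximum metric $\rho_{\max}((x_1,\dots,x_m),(y_1,\dots,y_m))=\max_j \rho(x_j,y_j)$. A comparison function is a map $\varphi:[0,\infty)\to[0,\infty)$ that is nondecreasing, right-continuous, and satisfies $\varphi(t)<t$ for all $t>0$. A map $f:Y^m\to Y$ on a metric space $(Y,\rho)$ is a $\varphi$-contraction if $\rho(f(x),f(y))\le\varphi(\rho_{\max}(x,y))$ for all $x,y\in Y^m$. It is Meir-Keeler if for every $\varepsilon>0$ there is $\delta_\varepsilon>0$ such that $\rho(f(x),f(y))<\varepsilon$ for all $x,y\in Y^m$ with $\rho_{\max}(x,y)<\varepsilon+\delta_\varepsilon$. A generalized possibly infinite iterated function system of order $m$ is a pair $\mathcal{F}=((X,d),(f_i)_{i\in I})$, where $(X,d)$ is a metric space, each $f_i:X^m\to X$ is continuous, and the family $(f_i)_{i\in I}$ is bounded, i.e. $\bigcup_{i\in I}f_i(B)$ is bounded for every bounded $B\subseteq X^m$. Code space: $\Omega_1=I$, $\Omega_{k+1}=\Omega_k\times\dots\times\Omega_k$ ($m$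 times), and $\Omega=\Omega_1\times\Omega_2\times\cdots$. Elements of $\Omega$ are written $\alpha=\alpha^1\alpha^2\dots\alpha^k\dots$ with $\alpha^k\in\Omega_k$; for $k\ge2$ write $\alpha^k=\alpha^k_1\alpha^k_2\dots\alpha^k_m$ with $\alpha^k_i\in\Omega_{k-1}$, and for $i\in\{1,\dots,m\}$ put $\alpha(i)=\alpha^2_i\alpha^3_i\alpha^4_i\dots\in\Omega$. $\Omega$ is endowed with the metric $d(\alpha,\beta)=\sum_{k\ge1}c^k\,\delta(\alpha^k,\beta^k)$, where $c\in(0,1)$ is fixed and $\delta(\alpha^k,\beta^k)$ is $1$ if $\alpha^k\neq\beta^k$ and $0$ otherwise. $\mathcal{C}$ is the set of continuous bounded functions $f:\Omega\to X$ with the metric $d_u(f,g)=\sup_{\alpha\in\Omega}d(f(\alpha),g(\alpha))$; $\mathcal{C}^m$ carries the corresponding maximum metric. The operator $H_{\mathcal{F}}:\mathcal{C}^m\to\mathcal{C}$ is $H_{\mathcal{F}}(g_1,\dots,g_m)(\alpha)=f_{\alpha^1}(g_1(\alpha(1)),\dots,g_m(\alpha(m)))$ for $\alpha=\alpha^1\alpha^2\dots\in\Omega$. *)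

(* Defs.v *)
From HB Require Import structures.
From mathcomp Require Import all_boot all_order all_algebra.
From mathcomp Require Import all_classical all_reals all_analysis.

Set Implicit Arguments.
Unset Strict Implicit.
Unset Printing Implicit Defensive.

Import Order.TTheory GRing.Theory Num.Theory.
Import numFieldNormedType.Exports.
Import metricType_numDomainType.

Local Open Scope classical_set_scope.
Local Open Scope ring_scope.

(* Y^m with the maximum metric; an alias of 'I_m -> Y, so that its topology is
   the one of mdist_max and not one inherited from the function type. *)
Definition mpow (m : nat) (Y : Type) : Type := 'I_m -> Y.

Section PowerMetric.
Context {R : realType} (Y : metricType R) (m : nat).

HB.instance Definition _ := gen_eqMixin (mpow m Y).
HB.instance Definition _ := gen_choiceMixin (mpow m Y).

(* Distances are nonnegative, so that for 0 < m the default value 0 does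
   not affect the maximum. *)
Definition mdist_max (x y : mpow m Y) : R :=
  \big[Num.max/0]_(j < m) mdist (x j) (y j).

Lemma mdist_maxxx x : mdist_max x x = 0.
Proof.
by apply: bigmax_eq_id => j _; rewrite mdistxx.
Qed.

Lemma mdist_max_pos x y : mdist_max x y = 0 -> x = y.
Proof.
move=> xy0; apply/funext => j; apply: mdist_positivity; apply/eqP.
rewrite eq_le mdist_ge0 andbT -xy0.
exact: (le_bigmax 0 (fun j => mdist (x j) (y j)) j).
Qed.

Lemma mdist_maxC x y : mdist_max x y = mdist_max y x.
Proof. by apply: eq_bigr => j _; exact: metric_sym. Qed.

Lemma mdist_max_triangle y x z :
  mdist_max x z <= mdist_max x y + mdist_max y z.
Proof.
have ge0 u v : 0 <= mdist_max u v by exact: bigmax_ge_id.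
apply: bigmax_le => [|j _]; first exact: addr_ge0.
apply: le_trans (metric_triangle _ (y j) _) _; apply: lerD.
  exact: (le_bigmax 0 (fun j => mdist (x j) (y j)) j).
exact: (le_bigmax 0 (fun j => mdist (y j) (z j)) j).
Qed.

HB.instance Definition _ := isMetric.Build R (mpow m Y)
  mdist_maxxx mdist_max_pos mdist_maxC mdist_max_triangle.

End PowerMetric.

Definition metric_bounded {R : realType} {Y : metricType R} (A : set Y) : Prop :=
  exists M : R, forall x y, A x -> A y -> mdist x y <= M.

(* Equipped below with the supremum metric; for T empty, sup set0 = 0. *)
Record bcfun {R : realType} (T : topologicalType) (Y : metricType R) : Type :=
  BCFun {
    bcfun_val :> T -> Y;
    bcfun_cont : continuous bcfun_val;
    bcfun_bounded : metric_bounded (range bcfun_val) }.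

Section UniformMetric.
Context {R : realType} (T : topologicalType) (Y : metricType R).
Local Notation C := (bcfun T Y).

HB.instance Definition _ := gen_eqMixin C.
HB.instance Definition _ := gen_choiceMixin C.

Definition mdist_unif (f g : C) : R :=
  sup (range (fun a => mdist (f a) (g a))).

Lemma bcfun_eq (f g : C) : f =1 g -> f = g.
Proof.
case: f g => [f cf bf] [g cg bg] /= /funext fg; subst g.
by congr BCFun; exact: Prop_irrelevance.
Qed.

Let range_empty (h : T -> R) : ~ inhabited T -> range h = set0.
Proof. by move=> T0; apply/seteqP; split => // y [b]; case: T0; exists. Qed.

Lemma mdist_unif_has_ubound (f g : C) :
  has_ubound (range (fun a => mdist (f a) (g a))).
Proof.
have [[a]|T0] := pselect (inhabited T); last first.
  by exists 0 => y [a]; case: T0; exists.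
have [Mf bf] := bcfun_bounded f; have [Mg bg] := bcfun_bounded g.
exists (Mf + mdist (f a) (g a) + Mg) => _ [b _ <-].
apply: le_trans (metric_triangle _ (g a) _) _; apply: lerD; last first.
  by apply: bg; [exists a|exists b].
apply: le_trans (metric_triangle _ (f a) _) _; apply: lerD => //.
by apply: bf; [exists b|exists a].
Qed.

Lemma mdist_unif_ge (f g : C) a : mdist (f a) (g a) <= mdist_unif f g.
Proof. by apply: ub_le_sup; [exact: mdist_unif_has_ubound|exists a]. Qed.

Lemma mdist_unif_le (f g : C) (M : R) :
  0 <= M -> (forall a, mdist (f a) (g a) <= M) -> mdist_unif f g <= M.
Proof.
move=> M0 fgM; have [[a]|T0] := pselect (inhabited T).
  by apply: ge_sup; [exists (mdist (f a) (g a)), a|move=> _ [b _ <-]].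
by rewrite /mdist_unif range_empty// sup0.
Qed.

Lemma mdist_unif_ge0 (f g : C) : 0 <= mdist_unif f g.
Proof.
have [[a]|T0] := pselect (inhabited T).
  exact: le_trans (mdist_ge0 _ _) (mdist_unif_ge f g a).
by rewrite /mdist_unif range_empty// sup0.
Qed.

Lemma mdist_unifxx f : mdist_unif f f = 0.
Proof.
apply/eqP; rewrite eq_le mdist_unif_ge0 andbT.
by apply: mdist_unif_le => // a; rewrite mdistxx.
Qed.

Lemma mdist_unif_pos f g : mdist_unif f g = 0 -> f = g.
Proof.
move=> fg0; apply: bcfun_eq => a; apply: mdist_positivity; apply/eqP.
by rewrite eq_le mdist_ge0 andbT -fg0 mdist_unif_ge.
Qed.

Lemma mdist_unifC f g : mdist_unif f g = mdist_unif g f.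
Proof.
rewrite /mdist_unif (_ : (fun a => _) = (fun a => mdist (g a) (f a)))//.
by apply/funext => a; exact: metric_sym.
Qed.

Lemma mdist_unif_triangle g f h :
  mdist_unif f h <= mdist_unif f g + mdist_unif g h.
Proof.
apply: mdist_unif_le => [|a]; first by rewrite addr_ge0 ?mdist_unif_ge0.
apply: le_trans (metric_triangle _ (g a) _) _.
by apply: lerD; exact: mdist_unif_ge.
Qed.

HB.instance Definition _ := isMetric.Build R C
  mdist_unifxx mdist_unif_pos mdist_unifC mdist_unif_triangle.

End UniformMetric.

Section Contractions.
Context {R : realType}.

(* A map from [0, oo[ to itself is represented by a function on R, of which only
   the values on [0, oo[ are constrained. *)
Definition comparison_function (phi : R -> R) : Prop :=
  [/\ forall t, 0 <= t -> 0 <= phi t,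
      forall s t, 0 <= s -> s <= t -> phi s <= phi t,
      forall t, 0 <= t -> phi s @[s --> t^'+] --> phi t
    & forall t, 0 < t -> phi t < t].

Definition phi_contraction (phi : R -> R) {Y : metricType R} {m : nat}
    (f : mpow m Y -> Y) : Prop :=
  forall x y : mpow m Y, mdist (f x) (f y) <= phi (mdist x y).

Definition meir_keeler {Y : metricType R} {m : nat} (f : mpow m Y -> Y) : Prop :=
  forall e : R, 0 < e -> exists2 d : R, 0 < d &
    forall x y : mpow m Y, mdist x y < e + d -> mdist (f x) (f y) < e.

End Contractions.

(* Generalized possibly infinite iterated function systems of order m. *)
Record gpifs {R : realType} (X : metricType R) (I : Type) (m : nat) : Type :=
  GPIFS {
    gpifs_fun :> I -> mpow m X -> X;
    gpifs_cont : forall i, continuous (gpifs_fun i);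
    gpifs_bounded : forall B : set (mpow m X), metric_bounded B ->
      metric_bounded (\bigcup_i (gpifs_fun i @` B)) }.

(* Levels are counted from 0: code_level I m k is Omega_(k+1). *)
Fixpoint code_level (I : Type) (m k : nat) : Type :=
  if k is k'.+1 then 'I_m -> code_level I m k' else I.

(* The parameter c of the metric, with the proof that it lies in ]0, 1[, is part
   of the type so that the metric can be attached to it. A code alpha is the
   function k |-> alpha^(k+1). *)
Definition codespace {R : realType} (c : R) (c01 : 0 < c < 1)
  (I : Type) (m : nat) : Type := forall k : nat, code_level I m k.

Section CodeMetric.
Context {R : realType} (c : R) (c01 : 0 < c < 1) (I : Type) (m : nat).
Local Notation Omega := (codespace c01 I m).

HB.instance Definition _ := gen_eqMixin Omega.
HB.instance Definition _ := gen_choiceMixin Omega.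

Definition code_term (a b : Omega) (k : nat) : R :=
  c ^+ k.+1 * `[< a k <> b k >]%:R.

Definition mdist_code (a b : Omega) : R := limn (series (code_term a b)).

Let c_gt0 : 0 < c. Proof. by case/andP: c01. Qed.
Let c_lt1 : c < 1. Proof. by case/andP: c01. Qed.

Lemma code_term_ge0 a b k : 0 <= code_term a b k.
Proof. by rewrite mulr_ge0 ?exprn_ge0 ?ler0n// ltW. Qed.

Lemma code_term_cvg a b : cvgn (series (code_term a b)).
Proof.
apply: (@series_le_cvg _ _ (geometric c c)) => [k|k|k|].
- exact: code_term_ge0.
- exact/geometric_ge0/ltW/c_gt0/ltW.
- rewrite /geometric /= -exprS /code_term.
  by rewrite ler_piMr ?exprn_ge0 ?lern1 ?leq_b1 ?ltW.
- by apply: is_cvg_geometric_series; rewrite gtr0_norm.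
Qed.

Lemma code_series_le a b n : series (code_term a b) n <= mdist_code a b.
Proof.
apply: nondecreasing_cvgn_le n; last exact: code_term_cvg.
by apply: nondecreasing_series => j _ _; exact: code_term_ge0.
Qed.

Lemma code_term_le a b k : code_term a b k <= mdist_code a b.
Proof.
apply: (@le_trans _ _ (series (code_term a b) k.+1)).
  rewrite seriesSr lerDr /series /=.
  by apply: sumr_ge0 => j _; exact: code_term_ge0.
exact: code_series_le.
Qed.

Lemma mdist_code_eq a b k : mdist_code a b < c ^+ k.+1 -> a k = b k.
Proof.
move=> ab; apply: contrapT => neq.
have := le_lt_trans (code_term_le a b k) ab.
by rewrite /code_term asboolT// mulr1 ltxx.
Qed.

Lemma mdist_codexx a : mdist_code a a = 0.
Proof.
rewrite /mdist_code (_ : series _ = cst 0); first exact: lim_cst.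
apply/funext => n; rewrite /series /= big1// => j _.
by rewrite /code_term asboolF ?mulr0//; apply.
Qed.

Lemma mdist_code_pos a b : mdist_code a b = 0 -> a = b.
Proof.
move=> ab0; apply: functional_extensionality_dep => k.
by apply: mdist_code_eq; rewrite ab0 exprn_gt0.
Qed.

Lemma mdist_codeC a b : mdist_code a b = mdist_code b a.
Proof.
rewrite /mdist_code; congr (limn (series _)); apply/funext => k.
by rewrite /code_term; congr (_ * (nat_of_bool _)%:R); apply: asbool_equiv_eq;
   split=> + /esym.
Qed.

Lemma mdist_code_triangle b a d :
  mdist_code a d <= mdist_code a b + mdist_code b d.
Proof.
rewrite /mdist_code -lim_seriesD; [|exact: code_term_cvg..].
apply: lim_series_le; first exact: code_term_cvg.
  by apply: is_cvg_seriesD; exact: code_term_cvg.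
move=> k; rewrite -[(_ + _) k]/(code_term a b k + code_term b d k).
rewrite -mulrDr; apply: ler_wpM2l; first by rewrite exprn_ge0// ltW.
rewrite -natrD ler_nat.
case: (asboolP (a k <> d k)) => // ad.
case: asboolP => //= /contrapT ab; case: asboolP => //= /contrapT bd.
by case: ad; rewrite ab.
Qed.

HB.instance Definition _ := isMetric.Build R Omega
  mdist_codexx mdist_code_pos mdist_codeC mdist_code_triangle.

(* alpha(i) = alpha^2_i alpha^3_i ... *)
Definition code_part (a : Omega) (i : 'I_m) : Omega := fun k => a k.+1 i.

Lemma code_part_lip (a b : Omega) (i : 'I_m) :
  c * mdist (code_part a i) (code_part b i) <= mdist a b.
Proof.
rewrite -ler_pdivlMl//.
apply: limr_le; first exact: code_term_cvg.
apply: nearW => n; rewrite ler_pdivlMl//.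
apply: le_trans (code_series_le a b n.+1).
rewrite /series /= big_nat_recl//= -[leLHS]add0r mulr_sumr.
apply: lerD; first exact: code_term_ge0.
apply: ler_sum => k _; rewrite /code_term mulrA -exprS.
apply: ler_wpM2l; first by rewrite exprn_ge0// ltW.
rewrite ler_nat; case: asboolP => //= ab; case: asboolP => // /contrapT ab'.
by case: ab; rewrite /code_part ab'.
Qed.

End CodeMetric.

Section Operator.
Context {R : realType} {X : metricType R} {I : Type} {m : nat}.
Context {c : R} (c01 : 0 < c < 1) (F : gpifs X I m).
Local Notation Omega := (codespace c01 I m).
Local Notation C := (bcfun Omega X).

(* a 0 is alpha^1, an element of I. *)
Definition operator_fun (g : mpow m C) (a : Omega) : X :=
  F (a 0%N) (fun j => g j (code_part a j)).

Lemma operator_continuous (g : mpow m C) : continuous (operator_fun g).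
Proof.
have [c0 _] := andP c01.
move=> a; pose u (b : Omega) : mpow m X := fun j => g j (code_part b j).
have cu : u b @[b --> a] --> u a.
  apply/(@cvgrPdist_lt _ _ _ (nbhs a)) => e e0.
  have gj (j : 'I_m) :
      \forall b \near a, mdist (g j (code_part a j)) (g j (code_part b j)) < e.
    have /(@cvgrPdist_lt _ _ _ (nbhs (code_part a j)))/(_ e e0) :=
      @bcfun_cont _ _ _ (g j) (code_part a j).
    move=> /nbhs_mdistP[d /= d0 gd].
    apply/nbhs_mdistP; exists (c * d) => /=; first exact: mulr_gt0.
    move=> b ab; apply: gd => /=.
    by rewrite -(ltr_pM2l c0); apply: le_lt_trans (code_part_lip _ _ _) ab.
  have gs : \forall b \near nbhs a, forall j : 'I_m,
      mdist (g j (code_part a j)) (g j (code_part b j)) < e.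
    exact: filter_forall.
  apply: filterS gs => b gb.
  by apply: bigmax_lt => // j _; exact: gb.
have cF := @gpifs_cont _ _ _ _ F (a 0%N) (u a).
have cFu : (F (a 0%N) \o u) b @[b --> a] --> F (a 0%N) (u a).
  exact: cvg_comp cu cF.
apply/(@cvgrPdist_lt _ _ _ (nbhs a)) => e e0.
have /(@cvgrPdist_lt _ _ _ (nbhs a))/(_ e e0) := cFu.
have a0 : \forall b \near a, a 0%N = b 0%N.
  apply/nbhs_mdistP; exists (c ^+ 1) => /=; first exact: exprn_gt0.
  by move=> b; exact: mdist_code_eq.
move=> uab; near=> b; rewrite /operator_fun.
have <- : a 0%N = b 0%N by near: b.
by near: b.
Unshelve. all: by end_near.
Qed.

Lemma operator_bounded (g : mpow m C) : metric_bounded (range (operator_fun g)).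
Proof.
pose B : set (mpow m X) := [set x | forall j, range (g j) (x j)].
have [|M FM] := @gpifs_bounded _ _ _ _ F B.
  have /choice[M gM] : forall j, exists M : R,
      forall x y, range (g j) x -> range (g j) y -> mdist x y <= M.
    by move=> j; exact: bcfun_bounded.
  exists (\big[Num.max/0]_(j < m) M j) => x y xB yB.
  apply: le_bigmax2 => j _; exact: gM.
exists M => _ _ [a _ <-] [b _ <-].
by apply: FM; [exists (a 0%N)|exists (b 0%N)] => //;
  eexists; try reflexivity; move=> j; eexists.
Qed.

Definition gpifs_operator (g : mpow m C) : C :=
  BCFun (@operator_continuous g) (operator_bounded g).

End Operator.

Arguments gpifs_operator {R X I m c} c01 F g.

(* Main.v *)
Require Import Defs.
From mathcomp Require Import all_boot all_order all_algebra.
From mathcomp Require Import all_classical all_reals all_analysis.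

(** The operator inherits the contraction property of its components: at a code
    [a] the two values of [gpifs_operator c01 F] are images under the single map
    [F (a 0)] of points of [X^m] whose distance is at most the distance between
    the two arguments, a bound that does not depend on [a]; since [phi] is
    nondecreasing, taking the supremum over [a] keeps the bound [phi]
    ([phi_contraction_operator]).  A [phi]-contraction is in turn Meir-Keeler
    ([meir_keeler_phi_contraction]): right-continuity carries the inequality
    [phi e < e] a little to the right of [e], and by monotonicity the strict
    bound at one such point [s > e] serves for every distance below [s]. *)

Set Implicit Arguments.
Unset Strict Implicit.
Unset Printing Implicit Defensive.

Import Order.TTheory GRing.Theory Num.Theory.
Import numFieldNormedType.Exports.

Local Open Scope classical_set_scope.
Local Open Scope ring_scope.

(** Right-continuity excludes a jump of [phi] immediately after [e] to values
    that are at least [e]. *)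
Lemma comparison_function_lt_right (R : realType) (phi : R -> R) (e : R) :
  comparison_function phi -> 0 < e -> exists2 s, e < s & phi s < e.
Proof.
move=> [_ _ phi_rc phi_lt] e0.
have phi_lte : \forall s \near e^'+, phi s < e.
  exact: (cvgr_lt (phi e) (phi_rc _ (ltW e0)) e (phi_lt _ e0)).
have [s [es phis]] : exists s, e < s /\ phi s < e.
  apply: (@filter_ex _ (e^'+)); near=> s; split; near: s => //.
  exact: nbhs_right_gt.
by exists s.
Unshelve. all: by end_near.
Qed.

Lemma meir_keeler_phi_contraction (R : realType) (phi : R -> R)
    (Y : metricType R) (m : nat) (f : mpow m Y -> Y) :
  comparison_function phi -> phi_contraction phi f -> meir_keeler f.
Proof.
move=> phiP fphi e e0; have [s es phis] := comparison_function_lt_right phiP e0.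
have [_ phi_nd _ _] := phiP.
exists (s - e) => [|x y]; first by rewrite subr_gt0.
rewrite addrC subrK => /ltW xys; apply: le_lt_trans phis.
by apply: le_trans (fphi x y) _; apply: phi_nd => //; exact: mdist_ge0.
Qed.

Lemma mdist_max_eval_le (R : realType) (T : topologicalType) (Y : metricType R)
    (m : nat) (g h : mpow m (bcfun T Y)) (t : 'I_m -> T) :
  mdist_max (fun j => g j (t j)) (fun j => h j (t j)) <= mdist_max g h.
Proof. by apply: le_bigmax2 => j _; exact: mdist_unif_ge. Qed.

Lemma phi_contraction_operator (R : realType) (X : metricType R) (I : Type)
    (m : nat) (c : R) (c01 : 0 < c < 1) (phi : R -> R) (F : gpifs X I m) :
  comparison_function phi -> (forall i, phi_contraction phi (F i)) ->
  phi_contraction phi (gpifs_operator c01 F).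
Proof.
move=> [phi_ge0 phi_nd _ _] Fphi g h.
apply: mdist_unif_le => [|a]; first exact/phi_ge0/mdist_ge0.
apply: le_trans (Fphi _ _ _) _.
by apply: phi_nd; [exact: mdist_ge0|exact: mdist_max_eval_le].
Qed.

Theorem proposition3p6 (R : realType) (X : metricType R) (I : Type) (m : nat)
    (hX : inhabited X) (hI : inhabited I) (hm : (0 < m)%N)
    (c : R) (c01 : 0 < c < 1) (phi : R -> R) (F : gpifs X I m) :
  comparison_function phi ->
  (forall i : I, phi_contraction phi (F i)) ->
  meir_keeler (gpifs_operator c01 F).
Proof.
move=> phiP Fphi; apply: (meir_keeler_phi_contraction phiP).
exact: phi_contraction_operator.
Qed.
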